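(* Let $G$ be a paratopological group which is pseudobounded, locally precompact, and a SIN-group. Then $G$ is precompact.
   Context: A paratopological group is a group $G$ endowed with a topology such that the multiplication $G\times G\to G$, $(x,y)\mapsto xy$, is continuous (inversion need not be continuous, and no separation axiom is assumed). For $U\subseteq G$ and $n\ge 1$, $U^n=\{u_1u_2\cdots u_n: u_1,\dots,u_n\in U\}$. $G$ is pseudobounded if for any neighborhood $U$ of the identity there exists a positive integer $n$ with $U^n=G$. A subset $A\subseteq G$ is left (resp. right) precompact if for any neighborhood $U$ of the identity of $G$ there exists a finite subset $F$ of $G$ such that $FU\supseteq A$ (resp. $UF\supseteq A$); $A$ is precompact if it is both left and right precompact. The group $G$ is precompact if the set $A=G$ is precompact. $G$ is locally precompact if the identity of $G$ has a precompact neighborhood. A neighborhood $U$ of the identity is invariant if $U=g^{-1}Ug$ for each $g\in G$. $G$ is a SIN-group if it has a base at the identity consisting of invariant neighborhoods. *)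

(* Defs.v *)
From HB Require Import structures.
From mathcomp Require Import all_boot.
From mathcomp Require Import all_classical topology.

Set Implicit Arguments.
Unset Strict Implicit.
Unset Printing Implicit Defensive.

Local Open Scope classical_set_scope.
Local Open Scope group_scope.

(* [Group] is the class of abstract, possibly infinite groups of the file
   monoid, not that of finite groups. *)
HB.structure Definition PreTopologicalGroup :=
  {G of Topological G & Group G}.

HB.mixin Record PreTopologicalGroup_isParatopologicalGroup G
    & PreTopologicalGroup G := {
  mulg_continuous : continuous (fun x : G * G => x.1 * x.2) ;
}.

#[short(type="paratopologicalGroupType")]
HB.structure Definition ParatopologicalGroup :=
  {G of PreTopologicalGroup G & PreTopologicalGroup_isParatopologicalGroup G}.

Definition set_mulg (G : groupType) (A B : set G) : set G :=
  [set x * y | x in A & y in B].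

Definition set_expg (G : groupType) (U : set G) (n : nat) : set G :=
  [set \prod_(i < n) u i | u in [set u : 'I_n -> G | forall i, U (u i)]].

Section ParatopologicalGroups.
Variable G : paratopologicalGroupType.

(* Throughout, a neighborhood of a point is any member of [nbhs]: it need not
   be open. *)

Definition pseudobounded : Prop :=
  forall U : set G, nbhs (1 : G) U ->
    exists n : nat, (0 < n)%N /\ set_expg U n = [set: G].

Definition left_precompact (A : set G) : Prop :=
  forall U : set G, nbhs (1 : G) U ->
    exists F : set G, finite_set F /\ A `<=` set_mulg F U.

Definition right_precompact (A : set G) : Prop :=
  forall U : set G, nbhs (1 : G) U ->
    exists F : set G, finite_set F /\ A `<=` set_mulg U F.

Definition precompact_set (A : set G) : Prop :=
  left_precompact A /\ right_precompact A.

Definition precompact_group : Prop := precompact_set [set: G].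

Definition locally_precompact : Prop :=
  exists U : set G, nbhs (1 : G) U /\ precompact_set U.

(* [x ^ g] is the conjugate [g^-1 * (x * g)]. *)
Definition invariant_set (U : set G) : Prop :=
  forall g : G, U = [set x ^ g | x in U].

Definition SIN_group : Prop :=
  exists B : set (set G),
    (forall U, B U -> nbhs (1 : G) U /\ invariant_set U) /\
    (forall V, nbhs (1 : G) V -> exists U, B U /\ U `<=` V).

End ParatopologicalGroups.

Arguments pseudobounded : clear implicits.
Arguments precompact_group : clear implicits.
Arguments locally_precompact : clear implicits.
Arguments SIN_group : clear implicits.

(* Main.v *)
(* If W is a precompact neighborhood of the identity, pseudoboundedness gives
   G = W^n, so it suffices that left precompact sets are stable under products.
   For V invariant with V V `<=` U, covers A `<=` F V and B `<=` E V give
   A B `<=` F V E V = (F E) (V V) `<=` (F E) U. *)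
From mathcomp Require Import all_boot.
From mathcomp Require Import all_classical topology.
Require Import Defs.

Set Implicit Arguments.
Unset Strict Implicit.
Unset Printing Implicit Defensive.

Local Open Scope classical_set_scope.
Local Open Scope group_scope.

Lemma invariant_setJ (G : paratopologicalGroupType) (V : set G) (v g : G) :
  invariant_set V -> V v -> V (v ^ g).
Proof. by move=> Vinv Vv; rewrite (Vinv g); exists v. Qed.

(** Continuity of multiplication at [(1, 1)] gives a box [A] times [B] mapped into [U]; the
    intersection of its two sides serves as [V]. *)
Lemma nbhs1_mul (G : paratopologicalGroupType) (U : set G) :
  nbhs (1 : G) U ->
  exists2 V : set G, nbhs (1 : G) V & set_mulg V V `<=` U.
Proof.
move=> U1.
have /= := @mulg_continuous G (1, 1) U; rewrite mulg1 => /(_ U1).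
case=> -[A B] /= [A1 B1] ABU; exists (A `&` B); first exact: filterI.
by move=> _ [x [Ax _] [y [_ By] <-]]; exact: (ABU (x, y)).
Qed.

Lemma left_precompact1 (G : paratopologicalGroupType) :
  left_precompact [set (1 : G)].
Proof.
move=> U /nbhs_singleton U1; exists [set 1]; split; first exact: finite_set1.
by move=> _ ->; exists 1 => //; exists 1; rewrite ?mulg1.
Qed.

Lemma sub_left_precompact (G : paratopologicalGroupType) (A B : set G) :
  A `<=` B -> left_precompact B -> left_precompact A.
Proof.
move=> AB Bpc U /Bpc[F [finF BFU]]; exists F; split=> //.
exact: subset_trans BFU.
Qed.

Lemma SIN_left_precompactM (G : paratopologicalGroupType) (A B : set G) :
  SIN_group G -> left_precompact A -> left_precompact B ->
  left_precompact (set_mulg A B).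
Proof.
move=> [N [Ninv Nbase]] Apc Bpc U /nbhs1_mul[W /Nbase[V [NV VW]] WWU].
have [V1 Vinv] := Ninv V NV.
have [F [finF AFV]] := Apc V V1; have [E [finE BEV]] := Bpc V V1.
exists (set_mulg F E); split; first exact: finite_image2.
move=> _ [_ /AFV[f Ff [v Vv <-]] [_ /BEV[e Ee [w Vw <-]] <-]].
(* Since [v * e = e * v ^ e], the product [f * v * (e * w)] equals [(f * e) * (v ^ e * w)], and
   invariance keeps [v ^ e] in [V]. *)
exists (f * e); first by exists f => //; exists e.
exists (v ^ e * w).
  apply: WWU; exists (v ^ e); first by apply: VW; exact: invariant_setJ.
  by exists w => //; exact: VW.
by rewrite conjgE !mulgA mulgK.
Qed.

Lemma SIN_left_precompactX (G : paratopologicalGroupType) (A : set G) n :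
  SIN_group G -> left_precompact A -> left_precompact (set_expg A n).
Proof.
move=> Gsin Apc; elim: n => [|n IHn].
  (* For exponent 0 the only product is the empty one, equal to 1. *)
  apply: sub_left_precompact (@left_precompact1 G).
  by move=> _ [u _ <-]; rewrite big_ord0.
apply: sub_left_precompact (SIN_left_precompactM Gsin Apc IHn).
(* Splitting off the factor of index 0 leaves a product of [n] elements of [A]. *)
move=> _ [u Au <-]; rewrite big_ord_recl; exists (u ord0); first exact: Au.
by exists (\prod_(i < n) u (lift ord0 i)) => //; eexists=> [i|//]; exact: Au.
Qed.

(** The same finite set [F] works on both sides: [f * v = v ^ f^-1 * f], so [F V] lies in [V F] when
    [V] is invariant. *)
Lemma SIN_left_right_precompact (G : paratopologicalGroupType) (A : set G) :
  SIN_group G -> left_precompact A -> right_precompact A.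
Proof.
move=> [N [Ninv Nbase]] Apc U /Nbase[V [NV VU]].
have [V1 Vinv] := Ninv V NV.
have [F [finF AFV]] := Apc V V1; exists F; split=> //.
move=> _ /AFV[f Ff [v Vv <-]].
exists (v ^ f^-1); first by apply: VU; exact: invariant_setJ.
by exists f => //; rewrite conjgE invgK !mulgA mulgVK.
Qed.

Theorem proposition2 (G : paratopologicalGroupType)
  (Gpb : pseudobounded G) (Glpc : locally_precompact G) (Gsin : SIN_group G) :
  precompact_group G.
Proof.
have [W [/Gpb[n [_ WnG]] [Wpc _]]] := Glpc.
(* Powers are handled on the left only; the right half for [G] then follows by conjugation. *)
have Gpc : left_precompact [set: G] by rewrite -WnG; exact: SIN_left_precompactX.
by split=> //; exact: SIN_left_right_precompact.
Qed.
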